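(* Suppose ${\rm int}(\Omega)\ne\emptyset$. Let $\lambda^*$ be an optimal solution of $({\rm SQP})$ and $\overline z=\sum_{i=1}^p\lambda_i^*a_i$. Then $$v({\rm SQP})\ \ge\ \max_{x\in\Omega}\|x-\overline z\|^2\ \ge\ v({\rm CC_B})\ \ge\ \left(\frac{1-\gamma}{\sqrt2+\gamma}\right)^2\cdot v({\rm SQP})\qquad( * )$$ for any $\gamma<1$ that is equal to or larger than the optimal value of the convex programming problem $$\min_{x\in\mathbb{R}^n}\max_{i=1,\dots,p}\frac{\|x-a_i\|}{r_i}.$$ Moreover, let $d_{\max}=\max_{i,j=1,\dots,p}\|a_i-a_j\|$ and $r_{\min}=\min_{i=1,\dots,p}r_i$, and suppose $d_{\max}<\sqrt2\, r_{\min}$; then $( * )$ holds with $$\gamma=\frac{d_{\max}}{\sqrt2\, r_{\min}}.$$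
   Context: Let $n,p\ge1$, $a_1,\dots,a_p\in\mathbb{R}^n$, $r_1,\dots,r_p\in(0,+\infty)$, and $\Omega=\{x\in\mathbb{R}^n:\|x-a_i\|^2\le r_i^2,\ i=1,\dots,p\}$, with $\|\cdot\|$ the Euclidean norm. The Chebyshev center problem is $({\rm CC_B})$: $\min_{z\in\mathbb{R}^n}\max_{x\in\Omega}\|x-z\|^2$. The standard quadratic programming relaxation is $$({\rm SQP})\quad \min_{\lambda}\ \sum_{i=1}^p\lambda_i(r_i^2-\|a_i\|^2)+\Big\|\sum_{i=1}^p\lambda_ia_i\Big\|^2\quad\text{s.t. }\sum_{i=1}^p\lambda_i=1,\ \lambda_i\ge0,\ i=1,\dots,p.$$ $v(\cdot)$ denotes the optimal value of a problem. *)

(* Defs.v *)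
From HB Require Import structures.
From mathcomp Require Import all_boot all_order all_algebra.
From mathcomp Require Import all_classical all_reals all_analysis.

Set Implicit Arguments.
Unset Strict Implicit.
Unset Printing Implicit Defensive.

Import Order.TTheory GRing.Theory Num.Theory.
Import numFieldNormedType.Exports.

Local Open Scope classical_set_scope.
Local Open Scope ring_scope.

(* The library norm on 'rV[R]_n is the sup norm, hence this definition. The
   library topology on 'rV[R]_n is nevertheless the Euclidean one. *)
Definition enorm (R : realType) (n : nat) (x : 'rV[R]_n) : R :=
  Num.sqrt (\sum_(k < n) x 0 k ^+ 2).

Definition ball_inter (R : realType) (n p : nat)
    (a : 'I_p -> 'rV[R]_n) (r : 'I_p -> R) : set 'rV[R]_n :=
  [set x | forall i, enorm (x - a i) ^+ 2 <= r i ^+ 2].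

(* Optimal values are infima and suprema in \bar R, so that they need no side
   condition of nonemptiness or boundedness. *)

Definition max_sqdist (R : realType) (n p : nat)
    (a : 'I_p -> 'rV[R]_n) (r : 'I_p -> R) (z : 'rV[R]_n) : \bar R :=
  ereal_sup [set (enorm (x - z) ^+ 2)%:E | x in ball_inter a r].

Definition chebyshev_val (R : realType) (n p : nat)
    (a : 'I_p -> 'rV[R]_n) (r : 'I_p -> R) : \bar R :=
  ereal_inf [set max_sqdist a r z | z in [set: 'rV[R]_n]].

Definition sqp_feasible (R : realType) (p : nat) : set ('I_p -> R) :=
  [set l | \sum_(i < p) l i = 1 /\ forall i, 0 <= l i].

Definition sqp_obj (R : realType) (n p : nat)
    (a : 'I_p -> 'rV[R]_n) (r : 'I_p -> R) (l : 'I_p -> R) : R :=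
  \sum_(i < p) l i * (r i ^+ 2 - enorm (a i) ^+ 2)
  + enorm (\sum_(i < p) l i *: a i) ^+ 2.

Definition sqp_optimal (R : realType) (n p : nat)
    (a : 'I_p -> 'rV[R]_n) (r : 'I_p -> R) (l : 'I_p -> R) : Prop :=
  sqp_feasible l /\
  forall l', sqp_feasible l' -> sqp_obj a r l <= sqp_obj a r l'.

Definition sqp_val (R : realType) (n p : nat)
    (a : 'I_p -> 'rV[R]_n) (r : 'I_p -> R) : \bar R :=
  ereal_inf [set (sqp_obj a r l)%:E | l in @sqp_feasible R p].

Definition minmax_ratio_val (R : realType) (n p : nat)
    (a : 'I_p -> 'rV[R]_n) (r : 'I_p -> R) : \bar R :=
  ereal_inf [set ereal_sup [set (enorm (x - a i) / r i)%:E | i in [set: 'I_p]]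
            | x in [set: 'rV[R]_n]].

(* For 0 < p, the real sup and inf below range over nonempty finite sets, hence
   are a maximum and a minimum. *)
Definition dmax (R : realType) (n p : nat) (a : 'I_p -> 'rV[R]_n) : R :=
  sup [set enorm (a ij.1 - a ij.2) | ij in [set: 'I_p * 'I_p]].

Definition rmin (R : realType) (p : nat) (r : 'I_p -> R) : R :=
  inf [set r i | i in [set: 'I_p]].

Definition approx_bounds (R : realType) (n p : nat)
    (a : 'I_p -> 'rV[R]_n) (r : 'I_p -> R) (z : 'rV[R]_n) (gamma : R) : Prop :=
  [/\ (max_sqdist a r z <= sqp_val a r)%E,
      (chebyshev_val a r <= max_sqdist a r z)%E &
      (((((1 - gamma) / (Num.sqrt 2 + gamma)) ^+ 2)%:E * sqp_val a r)
         <= chebyshev_val a r)%E].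

(* Main.v *)
Require Import Defs.
From HB Require Import structures.
From mathcomp Require Import all_boot all_order all_algebra.
From mathcomp Require Import all_classical all_reals all_analysis.
From mathcomp Require Import ring lra.

Set Implicit Arguments.
Unset Strict Implicit.
Unset Printing Implicit Defensive.

Import Order.TTheory GRing.Theory Num.Theory.
Import numFieldNormedType.Exports.

Local Open Scope classical_set_scope.
Local Open Scope ring_scope.

(* Let [w] be the barycenter of the [a i] with the optimal weights and [v] the
   value of (SQP). Moving the optimal weights towards a vertex of the simplex
   gives [v + |w - a i|^2 <= r i ^ 2], so every [w + y] with [|y|^2 = v] is
   within [sqrt 2 * r i] of [a i]. If [|c - a i| <= gamma * r i] for all [i],
   shrinking such a point towards [c] by the factor
   [s = (1 - gamma) / (sqrt 2 + gamma)] puts it in the intersection. Applied to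
   [y] and [-y], this gives two feasible points at distance [2 * s * sqrt v],
   one of which is at distance at least [s * sqrt v] from any given [z].
   The second part is Jung's inequality without its dimensional factor: for
   nearly maximal variance, the same perturbation bounds every [|z - a i|^2] by
   about the variance, which is at most half the squared diameter. *)

(** * The Euclidean norm *)

Lemma enorm_ge0 (R : realType) n (x : 'rV[R]_n) : 0 <= enorm x.
Proof. exact: sqrtr_ge0. Qed.

Lemma enorm_sqr (R : realType) n (x : 'rV[R]_n) :
  enorm x ^+ 2 = \sum_(k < n) x 0 k ^+ 2.
Proof. by rewrite sqr_sqrtr// sumr_ge0// => k _; rewrite sqr_ge0. Qed.

Lemma enorm_eq0 (R : realType) n (x : 'rV[R]_n) : enorm x = 0 -> x = 0.
Proof.
move=> x0; have := enorm_sqr x; rewrite x0 expr0n /= => /esym/eqP.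
rewrite psumr_eq0 => [/allP h|k _]; last exact: sqr_ge0.
apply/rowP => k; rewrite mxE; apply/eqP.
by have := h k (mem_index_enum k); rewrite sqrf_eq0.
Qed.

Lemma enormZ (R : realType) n c (x : 'rV[R]_n) :
  enorm (c *: x) = `|c| * enorm x.
Proof.
rewrite /enorm -sqrtr_sqr -sqrtrM ?sqr_ge0// mulr_sumr; congr Num.sqrt.
by apply: eq_bigr => k _; rewrite mxE exprMn.
Qed.

Lemma enormN (R : realType) n (x : 'rV[R]_n) : enorm (- x) = enorm x.
Proof. by rewrite -scaleN1r enormZ normrN1 mul1r. Qed.

(** Cauchy-Schwarz: the squared norm of [enorm y *: x - enorm x *: y] is [2 * (enorm x * enorm y)]
    times the gap between the two sides. *)
Lemma sum_mul_le_enorm (R : realType) n (x y : 'rV[R]_n) :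
  \sum_(k < n) x 0 k * y 0 k <= enorm x * enorm y.
Proof.
have [/enorm_eq0 ->|x0] := eqVneq (enorm x) 0.
  rewrite big1 ?mulr_ge0 ?enorm_ge0// => k _; by rewrite mxE mul0r.
have [/enorm_eq0 ->|y0] := eqVneq (enorm y) 0.
  rewrite big1 ?mulr_ge0 ?enorm_ge0// => k _; by rewrite mxE mulr0.
have xy_gt0 : 0 < enorm x * enorm y.
  by rewrite mulr_gt0// lt_def enorm_ge0 ?x0 ?y0.
have : 0 <= enorm (enorm y *: x - enorm x *: y) ^+ 2 by rewrite sqr_ge0.
have -> : enorm (enorm y *: x - enorm x *: y) ^+ 2 = 2 * (enorm x * enorm y) *
    (enorm x * enorm y - \sum_(k < n) x 0 k * y 0 k).
  transitivity (enorm y ^+ 2 * \sum_(k < n) x 0 k ^+ 2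
      + enorm x ^+ 2 * \sum_(k < n) y 0 k ^+ 2
      - 2 * (enorm x * enorm y) * \sum_(k < n) x 0 k * y 0 k).
    rewrite enorm_sqr !mulr_sumr -big_split -sumrB /=.
    by apply: eq_bigr => k _; rewrite !mxE; ring.
  by rewrite -!enorm_sqr; ring.
have c0 : 0 < 2 * (enorm x * enorm y) by lra.
by rewrite (pmulr_rge0 _ c0) subr_ge0.
Qed.

Lemma enormD (R : realType) n (x y : 'rV[R]_n) :
  enorm (x + y) <= enorm x + enorm y.
Proof.
rewrite -(@ler_pXn2r _ 2) ?nnegrE ?addr_ge0 ?enorm_ge0//.
have -> : enorm (x + y) ^+ 2 =
    enorm x ^+ 2 + enorm y ^+ 2 + 2 * \sum_(k < n) x 0 k * y 0 k.
  rewrite !enorm_sqr mulr_sumr -!big_split /=.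
  by apply: eq_bigr => k _; rewrite !mxE; ring.
have := sum_mul_le_enorm x y; nra.
Qed.

Lemma parallelogram (R : realType) n (x y : 'rV[R]_n) :
  enorm (x + y) ^+ 2 + enorm (x - y) ^+ 2 = 2 * (enorm x ^+ 2 + enorm y ^+ 2).
Proof.
rewrite !enorm_sqr -!big_split mulr_sumr /=.
by apply: eq_bigr => k _; rewrite !mxE; ring.
Qed.

Lemma enorm_delta (R : realType) n (k : 'I_n) :
  enorm (delta_mx 0 k : 'rV[R]_n) = 1.
Proof.
rewrite /enorm (bigD1 k)//= big1 => [|j jk]; rewrite mxE ?eqxx.
  by rewrite addr0 expr1n sqrtr1.
by rewrite (negbTE jk) andbF expr0n.
Qed.

(** * Barycenters, variance and weak duality *)

(* Huygens' identity; [- sqp_obj a (fun=> 0) l] is the variance of the points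
   [a i] with weights [l i]. *)
Lemma sum_sqdist_barycenter (R : realType) n p (a : 'I_p -> 'rV[R]_n) l x :
  \sum_(i < p) l i = 1 ->
  \sum_(i < p) l i * enorm (x - a i) ^+ 2 =
  enorm (x - \sum_(i < p) l i *: a i) ^+ 2 - sqp_obj a (fun=> 0) l.
Proof.
move=> l1.
have scalar (c : R) (b : 'I_p -> R) : \sum_(i < p) l i * (c - b i) ^+ 2 =
    (c - \sum_(i < p) l i * b i) ^+ 2
    + \sum_(i < p) l i * b i ^+ 2 - (\sum_(i < p) l i * b i) ^+ 2.
  transitivity (c ^+ 2 * (\sum_(i < p) l i) - 2 * c * (\sum_(i < p) l i * b i)
      + \sum_(i < p) l i * b i ^+ 2); last by rewrite l1; ring.
  rewrite !mulr_sumr -sumrB -big_split /=.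
  by apply: eq_bigr => i _; ring.
have zE k : (\sum_(i < p) l i *: a i) 0 k = \sum_(i < p) l i * a i 0 k.
  by rewrite summxE; apply: eq_bigr => i _; rewrite mxE.
have sumE (y : 'I_p -> 'rV[R]_n) : \sum_(i < p) l i * enorm (y i) ^+ 2 =
    \sum_(k < n) \sum_(i < p) l i * y i 0 k ^+ 2.
  rewrite exchange_big /=; apply: eq_bigr => i _.
  by rewrite enorm_sqr mulr_sumr.
rewrite sumE /sqp_obj.
have -> : \sum_(i < p) l i * (0 ^+ 2 - enorm (a i) ^+ 2) =
    - \sum_(i < p) l i * enorm (a i) ^+ 2.
  by rewrite -sumrN; apply: eq_bigr => i _; ring.
rewrite sumE !enorm_sqr opprD opprK addrA -big_split -sumrB /=.
apply: eq_bigr => k _; rewrite !mxE !zE -scalar.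
by apply: eq_bigr => i _; rewrite !mxE.
Qed.

Lemma sqp_objE (R : realType) n p (a : 'I_p -> 'rV[R]_n) r l :
  sqp_obj a r l = \sum_(i < p) l i * r i ^+ 2 + sqp_obj a (fun=> 0) l.
Proof.
rewrite /sqp_obj addrA -big_split /=; congr (_ + _).
by apply: eq_bigr => i _; ring.
Qed.

(** Average the constraints defining [ball_inter] with the weights [l], then apply Huygens'
    identity. *)
Lemma sqdist_le_sqp_obj (R : realType) n p (a : 'I_p -> 'rV[R]_n) r l x :
  sqp_feasible l -> ball_inter a r x ->
  enorm (x - \sum_(i < p) l i *: a i) ^+ 2 <= sqp_obj a r l.
Proof.
move=> [l1 l0] xO; rewrite sqp_objE -lerBlDr -sum_sqdist_barycenter//.
by apply: ler_sum => i _; rewrite ler_wpM2l.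
Qed.

(** * Moving weights towards a vertex of the simplex *)

Definition mix (R : realType) p (l : 'I_p -> R) (t : R) (j : 'I_p) :
    'I_p -> R :=
  fun i => (1 - t) * l i + t * (i == j)%:R.

(** The general module [V] covers both the points [a i] and, through [R^o], real coefficients. *)
Lemma sum_mix (R : realType) p (l : 'I_p -> R) t j (V : lmodType R)
    (F : 'I_p -> V) :
  \sum_(i < p) mix l t j i *: F i =
  (1 - t) *: (\sum_(i < p) l i *: F i) + t *: F j.
Proof.
have -> : t *: F j = \sum_(i < p) (t * (i == j)%:R) *: F i.
  rewrite (bigD1 j)//= eqxx mulr1 big1 ?addr0// => i /negbTE ->.
  by rewrite mulr0 scale0r.
rewrite scaler_sumr -big_split /=.
by apply: eq_bigr => i _; rewrite /mix [LHS]scalerDl scalerA.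
Qed.

Lemma mix_feasible (R : realType) p (l : 'I_p -> R) t j : 0 <= t <= 1 ->
  sqp_feasible l -> sqp_feasible (mix l t j).
Proof.
move=> /andP[t0 t1] [l1 l0]; split; last first.
  by move=> i; rewrite addr_ge0// mulr_ge0// subr_ge0.
have := sum_mix l t j (fun=> 1 : R^o).
under eq_bigr do rewrite /GRing.scale/= mulr1.
under [X in _ *: X]eq_bigr do rewrite /GRing.scale/= mulr1.
by move=> ->; rewrite l1 /GRing.scale/=; ring.
Qed.

(** The linear part interpolates exactly; strong convexity of the squared norm produces the last
    term. *)
Lemma sqp_obj_mix (R : realType) n p (a : 'I_p -> 'rV[R]_n) r l t j :
  sqp_obj a r (mix l t j) = (1 - t) * sqp_obj a r l + t * r j ^+ 2
    - t * (1 - t) * enorm (\sum_(i < p) l i *: a i - a j) ^+ 2.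
Proof.
rewrite /sqp_obj (sum_mix l t j (fun i => (r i ^+ 2 - enorm (a i) ^+ 2) : R^o)).
rewrite sum_mix /GRing.scale/=.
set z := \sum_(i < p) l i *: a i; set S := \sum_(i < p) _.
have : enorm ((1 - t) *: z + t *: a j) ^+ 2 = (1 - t) * enorm z ^+ 2
    + t * enorm (a j) ^+ 2 - t * (1 - t) * enorm (z - a j) ^+ 2.
  rewrite !enorm_sqr !mulr_sumr -big_split -sumrB /=.
  by apply: eq_bigr => k _; rewrite !mxE; ring.
rewrite /GRing.scale/= => ->; rewrite /S /GRing.scale/=; ring.
Qed.

(** First-order optimality: the slope of [sqp_obj_mix] at [t = 0] is the right side minus the left
    side, and it cannot be negative. *)
Lemma sqp_optimal_kkt (R : realType) n p (a : 'I_p -> 'rV[R]_n) r l j :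
  sqp_optimal a r l ->
  sqp_obj a r l + enorm (\sum_(i < p) l i *: a i - a j) ^+ 2 <= r j ^+ 2.
Proof.
move=> [lf lopt]; set v := sqp_obj a r l; set D := enorm _ ^+ 2.
have D0 : 0 <= D by rewrite sqr_ge0.
rewrite leNgt; apply/negP => lt_r.
(* With [delta = v + D - r j ^+ 2], the objective changes by [- e * (delta - e * D)]. This [e] gives
   [e * (D + delta) = delta / 2], hence a strict decrease. *)
pose e := (v + D - r j ^+ 2) / (2 * (D + (v + D - r j ^+ 2))).
have e0 : 0 < v + D - r j ^+ 2 by rewrite subr_gt0.
have den0 : 0 < 2 * (D + (v + D - r j ^+ 2)) by lra.
have t0 : 0 < e by rewrite divr_gt0.
have t1 : e <= 1 by rewrite ler_pdivrMr//; lra.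
have te : e * (2 * (D + (v + D - r j ^+ 2))) = v + D - r j ^+ 2.
  by rewrite divfK// gt_eqF.
have /lopt : sqp_feasible (mix l e j) by apply: mix_feasible => //; rewrite ltW.
rewrite sqp_obj_mix -/v -/D.
move=> h; have : e * (v + D - r j ^+ 2 - e * D) <= 0 by nra.
rewrite pmulr_rle0//; nra.
Qed.

(** * A center from nearly maximal variance (Jung) *)

Lemma exists_near_center (R : realType) n p (a : 'I_p -> 'rV[R]_n) (d e : R) :
  (0 < p)%N -> (forall i j, enorm (a i - a j) <= d) -> d ^+ 2 / 2 < e ->
  exists z, forall i, enorm (z - a i) ^+ 2 <= e.
Proof.
move=> p0 ad de.
have d2 : 0 <= d ^+ 2 by rewrite sqr_ge0.
pose f l := sqp_obj a (fun=> 0) l.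
(* Huygens' identity at each [a i], averaged over [i], shows that the mean squared mutual distance
   is twice the variance [- f l]. *)
have f_ge l : sqp_feasible l -> - (d ^+ 2 / 2) <= f l.
  move=> [l1 l0].
  have varE :
      \sum_(i < p) l i * enorm (a i - \sum_(j < p) l j *: a j) ^+ 2 = - f l.
    under eq_bigr do rewrite -enormN opprB.
    by rewrite sum_sqdist_barycenter// subrr enorm_sqr big1 ?sub0r// => k _;
      rewrite mxE expr0n.
  have : \sum_(i < p) l i * (\sum_(j < p) l j * enorm (a i - a j) ^+ 2)
      <= \sum_(i < p) l i * d ^+ 2.
    apply: ler_sum => i _; rewrite ler_wpM2l//.
    rewrite -[leRHS]mul1r -l1 mulr_suml; apply: ler_sum => j _.
    by rewrite ler_wpM2l// lerXn2r ?nnegrE ?enorm_ge0//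
      (le_trans (enorm_ge0 _) (ad i j)).
  under eq_bigr do rewrite sum_sqdist_barycenter// mulrBr.
  rewrite sumrB varE -!mulr_suml l1 !mul1r -/(f l).
  lra.
pose S := [set f l | l in @sqp_feasible R p].
have hS : has_inf S.
  split; last by exists (- (d ^+ 2 / 2)) => _ [l /f_ge ? <-].
  exists (f (fun i => (i == Ordinal p0)%:R)) => //.
  exists (fun i => (i == Ordinal p0)%:R) => //.
  split=> [|i]; last by case: eqP.
  by rewrite (bigD1 (Ordinal p0))//= big1 ?addr0// => i /negbTE ->.
(* Here [t * e] is half the slack [e - d ^+ 2 / 2]. The tolerance [t * (e - d ^+ 2 / 2) / 2] on the
   infimum uses up the other half once divided by [t]. *)
pose t := (e - d ^+ 2 / 2) / (2 * e).
have e0 : 0 < e by lra.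
have tE : t * (2 * e) = e - d ^+ 2 / 2 by rewrite divfK// mulf_neq0 ?gt_eqF.
have t0 : 0 < t by rewrite divr_gt0//; lra.
have t1 : t < 1 by rewrite ltr_pdivrMr//; lra.
have eps0 : 0 < t * (e - d ^+ 2 / 2) / 2.
  by apply: divr_gt0 => //; apply: mulr_gt0 => //; lra.
have [_ [l lf <-] fl] := inf_adherent eps0 hS.
exists (\sum_(i < p) l i *: a i) => i.
have : inf S <= f (mix l t i).
  apply: ge_inf; first by case: hS.
  by exists (mix l t i) => //; apply: mix_feasible => //; lra.
rewrite /f sqp_obj_mix -/(f l) => fmix.
have {}f_ge := f_ge _ lf.
rewrite leNgt; apply/negP; set D := enorm _ ^+ 2 in fmix * => eD.
have : t * ((1 - t) * D) < t * (- f l + (e - d ^+ 2 / 2) / 2).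
  rewrite expr0n /= in fmix; lra.
rewrite ltr_pM2l// => h.
have : (1 - t) * e < (1 - t) * D by rewrite ltr_pM2l// subr_gt0.
lra.
Qed.

(** * Bounds on the optimal values *)

Lemma sqp_val_optimal (R : realType) n p (a : 'I_p -> 'rV[R]_n) r l :
  sqp_optimal a r l -> sqp_val a r = (sqp_obj a r l)%:E.
Proof.
move=> [lf lopt]; apply/eqP; rewrite eq_le; apply/andP; split.
  by apply: ereal_inf_lbound; exists l.
by apply: le_ereal_inf_tmp => _ [l' /lopt ? <-]; rewrite lee_fin.
Qed.

Lemma max_sqdist_le_sqp_val (R : realType) n p (a : 'I_p -> 'rV[R]_n) r l :
  sqp_optimal a r l ->
  (max_sqdist a r (\sum_(i < p) l i *: a i) <= sqp_val a r)%E.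
Proof.
move=> lopt; rewrite (sqp_val_optimal lopt).
apply: ge_ereal_sup => _ [x xO <-]; rewrite lee_fin.
by apply: sqdist_le_sqp_obj => //; case: lopt.
Qed.

(** The condition on [g] and [s] is the triangle-inequality budget: [c] costs [g * r i], and the
    shrunken displacement from [c] costs at most [s * (Num.sqrt 2 + g) * r i]. *)
Lemma max_sqdist_ge (R : realType) n p (a : 'I_p -> 'rV[R]_n) r
    (w c z : 'rV[R]_n) (v g s : R) :
  (0 < n)%N -> (forall i, 0 < r i) -> 0 <= v -> 0 <= s ->
  (forall i, v + enorm (w - a i) ^+ 2 <= r i ^+ 2) ->
  (forall i, enorm (c - a i) <= g * r i) ->
  g + s * (Num.sqrt 2 + g) <= 1 ->
  ((s ^+ 2 * v)%:E <= max_sqdist a r z)%E.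
Proof.
move=> n0 r0 v0 s0 vw cg gs.
pose q : 'rV[R]_n := Num.sqrt v *: delta_mx 0 (Ordinal n0).
have q2 : enorm q ^+ 2 = v.
  by rewrite enormZ enorm_delta mulr1 real_normK ?num_real// sqr_sqrtr.
have inO y : enorm y ^+ 2 = v -> ball_inter a r (c + s *: (w - c + y)).
  move=> yv i; have ri := r0 i.
  rewrite lerXn2r ?nnegrE ?enorm_ge0 ?(ltW ri)//.
  (* By the parallelogram law, the square of the left side is at most
     [2 * (enorm (w - a i) ^+ 2 + v)]. *)
  have wy : enorm (w - a i + y) <= Num.sqrt 2 * r i.
    rewrite -(@ler_pXn2r _ 2) ?nnegrE ?enorm_ge0//; last first.
      by rewrite mulr_ge0 ?sqrtr_ge0 ?(ltW ri).
    rewrite exprMn (sqr_sqrtr (ler0n _ 2)).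
    have := parallelogram (w - a i) y; rewrite yv.
    have := vw i; have := sqr_ge0 (enorm (w - a i - y));lra.
  have wcy : enorm (w - c + y) <= (Num.sqrt 2 + g) * r i.
    have -> : w - c + y = (w - a i + y) + (a i - c).
      by apply/rowP => k; rewrite !mxE; ring.
    rewrite (le_trans (enormD _ _))// mulrDl lerD//.
    by rewrite -enormN opprB.
  have -> : c + s *: (w - c + y) - a i = (c - a i) + s *: (w - c + y).
    by rewrite addrAC.
  rewrite (le_trans (enormD _ _))// enormZ ger0_norm//.
  have : s * enorm (w - c + y) <= s * ((Num.sqrt 2 + g) * r i).
    by rewrite ler_wpM2l.
  have : (g + s * (Num.sqrt 2 + g)) * r i <= 1 * r i by rewrite ler_pM2r.
  have := cg i; lra.
have le_max y : enorm y ^+ 2 = v ->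
    ((enorm (c + s *: (w - c + y) - z) ^+ 2)%:E <= max_sqdist a r z)%E.
  by move=> yv; apply: ereal_sup_ubound; exists (c + s *: (w - c + y));
    rewrite //; apply: inO.
(* The squared distances from [z] to the two feasible points sum to at least [2 * s ^+ 2 * v]. *)
have := parallelogram (c + s *: (w - c) - z) (s *: q).
have -> : c + s *: (w - c) - z + s *: q = c + s *: (w - c + q) - z.
  by apply/rowP => k; rewrite !mxE; ring.
have -> : c + s *: (w - c) - z - s *: q = c + s *: (w - c - q) - z.
  by apply/rowP => k; rewrite !mxE; ring.
rewrite enormZ exprMn q2 real_normK ?num_real// => par.
have base := sqr_ge0 (enorm (c + s *: (w - c) - z)).
have [h|h] := leP (s ^+ 2 * v) (enorm (c + s *: (w - c + q) - z) ^+ 2).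
  by apply: le_trans (le_max _ q2); rewrite lee_fin.
apply: le_trans (le_max (- q) _); last by rewrite enormN.
by rewrite lee_fin; lra.
Qed.

Lemma minmax_ratio_val_ge0 (R : realType) n p (a : 'I_p -> 'rV[R]_n) r :
  (0 < p)%N -> (forall i, 0 < r i) -> (0 <= minmax_ratio_val a r)%E.
Proof.
move=> p0 r0; apply: le_ereal_inf_tmp => _ [x _ <-].
apply: (@le_trans _ _ (enorm (x - a (Ordinal p0)) / r (Ordinal p0))%:E).
  by rewrite lee_fin divr_ge0 ?enorm_ge0 ?ltW.
by apply: ereal_sup_ubound; exists (Ordinal p0).
Qed.

(** Strictness gives an actual [c] without attainment of the infimum. *)
Lemma minmax_ratio_val_lt (R : realType) n p (a : 'I_p -> 'rV[R]_n) r (g : R) :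
  (forall i, 0 < r i) -> (minmax_ratio_val a r < g%:E)%E ->
  exists c, forall i, enorm (c - a i) <= g * r i.
Proof.
move=> r0 /ereal_inf_lt[_ [c _ <-] cg]; exists c => i.
rewrite -ler_pdivrMr// -lee_fin; apply: le_trans (ltW cg).
by apply: ereal_sup_ubound; exists i.
Qed.

(** Recovers the sharp factor from the strictly smaller ones for which a center [c] is available. *)
Lemma sqrM_le_lim (R : realType) (s v X : R) : 0 < s -> 0 <= v ->
  (forall t, 0 <= t < s -> t ^+ 2 * v <= X) -> s ^+ 2 * v <= X.
Proof.
move=> s0 v0 h; rewrite leNgt; apply/negP => Xs.
have X0 : 0 <= X by have := h 0; rewrite lexx s0 expr0n mul0r; apply.
have sv : 0 < s ^+ 2 * v by apply: le_lt_trans Xs.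
(* Then [t = s * (1 - e)] gives [t ^+ 2 * v = X + e ^+ 2 * (s ^+ 2 * v)], which exceeds [X]. *)
pose e := (s ^+ 2 * v - X) / (2 * (s ^+ 2 * v)).
have eE : e * (2 * (s ^+ 2 * v)) = s ^+ 2 * v - X.
  by rewrite divfK// mulf_neq0 ?gt_eqF.
have e0 : 0 < e by rewrite divr_gt0//; lra.
have e1 : e < 1 by rewrite ltr_pdivrMr//; lra.
have /h : 0 <= s * (1 - e) < s.
  by rewrite mulr_ge0 ?(ltW s0)//=; [rewrite gtr_pMr//; lra | lra].
have : 0 < e ^+ 2 * (s ^+ 2 * v) by rewrite mulr_gt0// exprn_gt0.
nra.
Qed.

Lemma approx_bounds_ratio (R : realType) n p (a : 'I_p -> 'rV[R]_n) r l
    (g : R) :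
  (0 < n)%N -> (0 < p)%N -> (forall i, 0 < r i) -> ball_inter a r !=set0 ->
  sqp_optimal a r l -> g < 1 -> (minmax_ratio_val a r <= g%:E)%E ->
  approx_bounds a r (\sum_(i < p) l i *: a i) g.
Proof.
move=> n0 p0 r0 [x0 x0O] lopt g1 mg.
have g0 : 0 <= g.
  by rewrite -lee_fin; apply: le_trans mg; apply: minmax_ratio_val_ge0.
have v0 : 0 <= sqp_obj a r l.
  apply: le_trans (sqdist_le_sqp_obj (proj1 lopt) x0O); exact: sqr_ge0.
have sqrt2 : 0 < Num.sqrt (2 : R) by rewrite sqrtr_gt0.
split; first exact: max_sqdist_le_sqp_val.
  by apply: ereal_inf_lbound; exists (\sum_(i < p) l i *: a i).
rewrite (sqp_val_optimal lopt) -EFinM.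
apply: le_ereal_inf_tmp => _ [z _ <-].
have lower s : 0 <= s < (1 - g) / (Num.sqrt 2 + g) ->
    ((s ^+ 2 * sqp_obj a r l)%:E <= max_sqdist a r z)%E.
  move=> /andP[s0]; rewrite ltr_pdivlMr; last lra.
  (* [h] solves [h + s * (Num.sqrt 2 + h) = 1]; the strict bound on [s] amounts to [g < h]. *)
  move=> sg; pose h := (1 - s * Num.sqrt 2) / (1 + s).
  have hE : h * (1 + s) = 1 - s * Num.sqrt 2 by rewrite divfK// gt_eqF//; lra.
  have gh : g < h by rewrite ltr_pdivlMr; lra.
  have [c cP] : exists c, forall i, enorm (c - a i) <= h * r i.
    apply: minmax_ratio_val_lt => //.
    by apply: le_lt_trans mg _; rewrite lte_fin.
  apply: (@max_sqdist_ge _ _ _ _ _ (\sum_(i < p) l i *: a i) c _ _ h) => //.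
    by move=> i; apply: sqp_optimal_kkt.
  lra.
have s0 : 0 < (1 - g) / (Num.sqrt 2 + g) by rewrite divr_gt0; lra.
case: (max_sqdist a r z) lower => [X| |] lower.
- rewrite lee_fin; apply: sqrM_le_lim => // t /lower; by rewrite lee_fin.
- by rewrite leey.
- by have := lower 0; rewrite lexx s0 => /(_ isT).
Qed.

(** * The explicit ratio from [dmax] and [rmin] *)

Lemma enorm_le_dmax (R : realType) n p (a : 'I_p -> 'rV[R]_n) i j :
  enorm (a i - a j) <= dmax a.
Proof.
apply: ub_le_sup; last by exists (i, j).
(* Any upper bound suffices for [sup] to be a genuine supremum; the sum of all the distances is
   one. *)
exists (\sum_(ij : 'I_p * 'I_p) enorm (a ij.1 - a ij.2)) => _ [ij _ <-].
by rewrite (bigD1 ij)//= lerDl sumr_ge0// => *; apply: enorm_ge0.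
Qed.

Lemma rmin_le (R : realType) p (r : 'I_p -> R) i :
  (forall i, 0 < r i) -> rmin r <= r i.
Proof.
by move=> r0; apply: ge_inf; [exists 0 => _ [j _ <-]; apply: ltW | exists i].
Qed.

Lemma rmin_gt0 (R : realType) p (r : 'I_p -> R) :
  (0 < p)%N -> (forall i, 0 < r i) -> 0 < rmin r.
Proof.
move=> p0 r0.
have [i _ ri] := @Order.TotalTheory.arg_minP _ R _ (Ordinal p0) xpredT r isT.
apply: (lt_le_trans (r0 i)); apply: lb_le_inf; first by exists (r i), i.
by move=> _ [j _ <-]; apply: ri.
Qed.

(** With [g] the claimed bound, [g * rmin r] is Jung's radius [dmax a / Num.sqrt 2]; each [e > 0]
    supplies the strict slack that [exists_near_center] requires. *)
Lemma minmax_ratio_val_le_dmax (R : realType) n p (a : 'I_p -> 'rV[R]_n) r :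
  (0 < p)%N -> (forall i, 0 < r i) ->
  (minmax_ratio_val a r <= (dmax a / (Num.sqrt 2 * rmin r))%:E)%E.
Proof.
move=> p0 r0; apply/lee_addgt0Pr => e e0; rewrite -EFinD.
have m0 := rmin_gt0 p0 r0.
have sqrt2 : 0 < Num.sqrt (2 : R) by rewrite sqrtr_gt0.
have d0 : 0 <= dmax a.
  exact: le_trans (enorm_ge0 _) (enorm_le_dmax a (Ordinal p0) (Ordinal p0)).
set g := dmax a / _.
have g0 : 0 <= g by rewrite divr_ge0// mulr_ge0 ?ltW.
have gE : dmax a ^+ 2 / 2 = (g * rmin r) ^+ 2.
  have -> : dmax a = Num.sqrt 2 * (g * rmin r).
    by rewrite mulrCA divfK// gt_eqF ?mulr_gt0.
  by rewrite [X in X / _]exprMn (sqr_sqrtr (ler0n _ 2)) mulrAC divff ?mul1r.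
have ge : 0 <= g + e by lra.
have lt_ge : dmax a ^+ 2 / 2 < ((g + e) * rmin r) ^+ 2.
  have gm0 : 0 <= g * rmin r by rewrite mulr_ge0 ?(ltW m0).
  have gem0 : 0 <= (g + e) * rmin r by rewrite mulr_ge0 ?(ltW m0).
  by rewrite gE ltr_pXn2r ?nnegrE// ltr_pM2r// ltrDl.
have [z zP] := exists_near_center p0 (enorm_le_dmax a) lt_ge.
apply: (@le_trans _ _
    (ereal_sup [set (enorm (z - a i) / r i)%:E | i in [set: 'I_p]])).
  by apply: ereal_inf_lbound; exists z.
apply: ge_ereal_sup => _ [i _ <-]; rewrite lee_fin ler_pdivrMr//.
apply: (@le_trans _ _ ((g + e) * rmin r)); last by rewrite ler_wpM2l// rmin_le.
by rewrite -(@ler_pXn2r _ 2) ?nnegrE ?enorm_ge0 ?mulr_ge0 ?(ltW m0).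
Qed.

Theorem theorem9 (R : realType) (n p : nat) (hn : (0 < n)%N) (hp : (0 < p)%N)
    (a : 'I_p -> 'rV[R]_n) (r : 'I_p -> R) (hr : forall i, 0 < r i)
    (hint : interior (ball_inter a r) !=set0)
    (l : 'I_p -> R) (hl : sqp_optimal a r l) :
  (forall gamma : R, gamma < 1 -> (minmax_ratio_val a r <= gamma%:E)%E ->
     approx_bounds a r (\sum_(i < p) l i *: a i) gamma) /\
  (dmax a < Num.sqrt 2 * rmin r ->
     approx_bounds a r (\sum_(i < p) l i *: a i)
       (dmax a / (Num.sqrt 2 * rmin r))).

Proof.
have O0 : ball_inter a r !=set0 by case: hint => x /interior_subset; exists x.
split=> [gamma g1 mg|dr]; apply: approx_bounds_ratio => //.
  rewrite ltr_pdivrMr ?mul1r// mulr_gt0 ?sqrtr_gt0//; exact: rmin_gt0.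
exact: minmax_ratio_val_le_dmax.
Qed.
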